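(* Let $G$ be a finite group, let $U$ be a projective unitary representation of $G$ on a finite-dimensional multipartite Hilbert space given by tensor products of local unitaries, let $\rho$ be a multipartite state, and let $S:=\{g\in G\mid U(g)\rho U(g)^\dagger=\rho\}$. Then there exists a constant $\alpha>0$ such that, for every positive integer $k$, there exists an LOCC measurement $\{M^{(k)}_{gS}\}_{gS\in G/S}$ on $k|G/S|$ copies satisfying $$\mathrm{tr}\Big(M^{(k)}_{gS}\big(U(g)\rho U(g)^\dagger\big)^{\otimes k|G/S|}\Big)\ge1-|G/S|\,e^{-\alpha k}$$ for all $g\in G$.
   Context: The Hilbert space is $\bigotimes_{i=1}^m\mathcal{H}_i$, shared by $m$ parties; on multiple copies each party holds all its local copies. An LOCC measurement is a POVM whose outcome can be obtained by local operations and classical communication among the parties (including classical randomness and classical post-processing). $G/S$ is the set of left cosets. *)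

(* Defs.v *)
From HB Require Import structures.
From mathcomp Require Import all_boot all_order all_algebra all_fingroup.
From mathcomp Require Import reals.
From mathcomp Require Import complex.

Set Implicit Arguments.
Unset Strict Implicit.
Unset Printing Implicit Defensive.

Import Order.TTheory GRing.Theory Num.Theory.

Local Open Scope ring_scope.
Local Open Scope sesquilinear_scope.

(* A system of m parties is given by [H : 'I_m -> finType]: party i holds the
   Hilbert space C^{H i}, with an orthonormal basis labelled by [H i]. The total
   space has the product basis labelled by [joint H]. An operator between spaces
   with bases X and Y is a matrix indexed through [enum_rank] / [enum_val]. *)
Definition joint (m : nat) (H : 'I_m -> finType) : finType :=
  {dffun forall i : 'I_m, H i}.

Definition component (m : nat) (H : 'I_m -> finType) (x : joint H) (i : 'I_m) :
    H i :=
  (x : {dffun forall i : 'I_m, H i}) i.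

Notation "''Op' [ R ]_ X" := 'M[R[i]]_#|X|
  (at level 8, X at level 2, format "''Op' [ R ]_ X") : type_scope.

Section Operators.
Variable R : realType.

(* [0 <= z] in R[i] means that z is real and nonnegative, so that a positive
   operator is Hermitian. *)
Definition positive_op (n : nat) (A : 'M[R[i]]_n) : Prop :=
  forall v : 'cV[R[i]]_n, 0 <= (v^t* *m A *m v) 0 0.

Definition density (n : nat) (rho : 'M[R[i]]_n) : Prop :=
  positive_op rho /\ \tr rho = 1.

Definition povm (n : nat) (O : finType) (M : O -> 'M[R[i]]_n) : Prop :=
  (forall o, positive_op (M o)) /\ \sum_o M o = 1%:M.

Definition projective_unitary (G : finGroupType) (n : nat)
    (U : G -> 'M[R[i]]_n) : Prop :=
  (forall g, U g \is unitarymx) /\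
  (forall g h, exists2 c : R[i], `|c| = 1 & U g *m U h = c *: U (g * h)%g).

Definition unitary_conj (n : nat) (V A : 'M[R[i]]_n) : 'M[R[i]]_n :=
  V *m A *m V^t*.

Definition stabilizer (G : finGroupType) (n : nat)
    (U : G -> 'M[R[i]]_n) (rho : 'M[R[i]]_n) : {set G} :=
  [set g | unitary_conj (U g) rho == rho].

Variable m : nat.

Definition tensor (H H' : 'I_m -> finType)
    (A : forall i, 'M[R[i]]_(#|H' i|, #|H i|)) :
    'M[R[i]]_(#|joint H'|, #|joint H|) :=
  \matrix_(x, y)
    \prod_(i < m) A i (enum_rank (component (enum_val x) i))
                      (enum_rank (component (enum_val y) i)).

Definition local_unitary (H : 'I_m -> finType) (V : 'Op[R]_(joint H)) : Prop :=
  exists u : forall i, 'Op[R]_(H i),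
    (forall i, u i \is unitarymx) /\ V = tensor u.

(* n copies of the system, each party holding its n local copies. *)
Definition copies (n : nat) (H : 'I_m -> finType) : 'I_m -> finType :=
  fun i => {ffun 'I_n -> H i}.

(* The basis label of the c-th copy of the total space. *)
Definition copy (n : nat) (H : 'I_m -> finType) (x : joint (copies n H))
    (c : 'I_n) : joint H :=
  finfun (fun i => (component x i : {ffun 'I_n -> H i}) c) :
    {dffun forall i : 'I_m, H i}.

(* A^{⊗n}, with the tensor factors regrouped party by party. *)
Definition tensor_power (n : nat) (H : 'I_m -> finType)
    (A : 'Op[R]_(joint H)) : 'Op[R]_(joint (copies n H)) :=
  \matrix_(x, y)
    \prod_(c < n) A (enum_rank (copy (enum_val x) c))
                    (enum_rank (copy (enum_val y) c)).

(* Finite-round LOCC protocols on the system H with final outcomes in O.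
   - [Announce o]: stop with final outcome o. Classical post-processing is the
     labelling of the leaves, since distinct leaves may carry the same outcome.
   - [Toss p next]: draw a shared random j with probability p j and proceed with
     the protocol [next j].
   - [Round K next]: every party i performs a local instrument with Kraus
     operators [K i j : C^{H i} -> C^{H' i}], and broadcasts its outcome
     j : J i; the next step depends on the outcomes of all parties. A party that
     does nothing uses a single identity Kraus operator, so one party acting at
     a time is a special case. Local ancillas and partial traces are covered
     because the output space H' i is arbitrary, and withheld outcomes because
     the later steps may ignore them. *)
Inductive protocol (O : finType) (H : 'I_m -> finType) : Type :=
| Announce (o : O)
| Toss (J : finType) (p : J -> R) (p_ge0 : forall j, 0 <= p j)
    (p_sum1 : \sum_j p j = 1) (next : J -> protocol O H)
| Round (J H' : 'I_m -> finType)
    (K : forall i, J i -> 'M[R[i]]_(#|H' i|, #|H i|))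
    (K_complete : forall i, \sum_j (K i j)^t* *m K i j = 1%:M)
    (next : joint J -> protocol O H').

(* [effect P o] is the operator E such that running P on a state rho yields the
   final outcome o with probability tr (E rho). *)
Fixpoint effect (O : finType) (H : 'I_m -> finType) (P : protocol O H) (o : O) :
    'Op[R]_(joint H) :=
  match P with
  | Announce o' => (o' == o)%:R%:M
  | Toss J p _ _ next => \sum_j real_complex R (p j) *: effect (next j) o
  | Round J H' K _ next =>
      \sum_(j : joint J)
        let Kj := tensor (fun i => K i (component j i)) in
        Kj^t* *m effect (next j) o *m Kj
  end.

Definition locc_measurement (O : finType) (H : 'I_m -> finType)
    (M : O -> 'Op[R]_(joint H)) : Prop :=
  povm M /\ exists P : protocol O H, forall o, M o = effect P o.

End Operators.

(* The set G/S of left cosets, as a finite type, and the coset gS in it. *)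
Definition left_cosets (G : finGroupType) (S : {set G}) : finType :=
  {X : {set G} | X \in lcosets S [set: G]}.

Lemma lcoset_in_lcosets (G : finGroupType) (S : {set G}) (g : G) :
  (g *: S)%g \in lcosets S [set: G].
Proof. by apply/lcosetsP; exists g; rewrite ?inE. Qed.

Definition left_coset (G : finGroupType) (S : {set G}) (g : G) :
    left_cosets S :=
  exist _ (g *: S)%g (lcoset_in_lcosets S g).

(* Main.v *)
Require Import Defs.
From HB Require Import structures.
From mathcomp Require Import all_boot all_order all_algebra all_fingroup.
From mathcomp Require Import reals sequences exp.
From mathcomp Require Import complex.
From mathcomp Require Import ring lra.

(* A product of informationally complete local POVMs is informationally complete
   on the whole system, so it turns the |G/S| distinct states U(g) rho U(g)^*
   into distinct probability distributions. Measuring all copies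
   in this way leaves the classical problem of identifying a distribution from
   n i.i.d. samples. Maximum likelihood confuses p with q with probability at most
   (sum_w sqrt (p w * q w))^n, and by strict Cauchy-Schwarz this base is < 1. *)

Set Implicit Arguments.
Unset Strict Implicit.
Unset Printing Implicit Defensive.

Import Order.TTheory GRing.Theory Num.Theory.

Local Open Scope ring_scope.

(** * Identifying one of finitely many distributions from i.i.d. samples *)

Section MaximumLikelihood.
Variables (R : realType) (X W : finType) (p : X -> W -> R).
Hypothesis p_ge0 : forall x w, 0 <= p x w.
Hypothesis p_sum1 : forall x, \sum_w p x w = 1.

Definition bhattacharyya x y : R := \sum_w Num.sqrt (p x w) * Num.sqrt (p y w).

Lemma bhattacharyya_ge0 x y : 0 <= bhattacharyya x y.
Proof. by apply: sumr_ge0 => w _; rewrite mulr_ge0 ?sqrtr_ge0. Qed.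

(** The squared differences of the square roots sum to [2 - 2 * bhattacharyya x y]; if this
    vanished, the two distributions would agree pointwise. *)
Lemma bhattacharyya_lt1 x y : ~ p x =1 p y -> bhattacharyya x y < 1.
Proof.
move=> pxy; pose d w := (Num.sqrt (p x w) - Num.sqrt (p y w)) ^+ 2.
have d_ge0 w : true -> 0 <= d w by rewrite sqr_ge0.
have E : \sum_w d w = 2 - 2 * bhattacharyya x y.
  rewrite (eq_bigr (fun w => p x w + p y w
      - 2 * (Num.sqrt (p x w) * Num.sqrt (p y w)))); last first.
    move=> w _; rewrite /d.
    move: (sqr_sqrtr (p_ge0 x w)) (sqr_sqrtr (p_ge0 y w)).
    by set a := Num.sqrt _; set b := Num.sqrt _ => <- <-; ring.
  by rewrite sumrB big_split /= !p_sum1 -big_distrr.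
have : 0 <= \sum_w d w := sumr_ge0 _ d_ge0.
rewrite le_eqVlt => /predU1P[d0 | ]; last first.
  by rewrite E; lra.
case: pxy => w; have /(_ w isT)/eqP := psumr_eq0P d_ge0 (esym d0).
by rewrite sqrf_eq0 subr_eq0 eqr_sqrt // => /eqP.
Qed.

(* With [r = Num.sqrt], if [\prod p x <= \prod p y] then
   [\prod p x <= \prod (r (p x) * r (p y))]; summing the latter over all words
   gives a power of the Bhattacharyya coefficient. *)
Lemma likelihood_error n x y (E : pred {ffun 'I_n -> W}) :
  (forall w, E w -> \prod_c p x (w c) <= \prod_c p y (w c)) ->
  \sum_(w | E w) \prod_c p x (w c) <= bhattacharyya x y ^+ n.
Proof.
move=> Exy.
have -> : bhattacharyya x y ^+ n = \sum_(w : {ffun 'I_n -> W})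
    \prod_c (Num.sqrt (p x (w c)) * Num.sqrt (p y (w c))).
  rewrite -(bigA_distr_bigA (fun=> fun o => Num.sqrt (p x o) * Num.sqrt (p y o))).
  by rewrite prodr_const card_ord.
rewrite big_mkcond; apply: ler_sum => w _; rewrite big_split /=.
have rt_ge0 z : 0 <= \prod_c Num.sqrt (p z (w c)).
  by apply: prodr_ge0 => c _; apply: sqrtr_ge0.
have rtE z : \prod_c p z (w c) = (\prod_c Num.sqrt (p z (w c))) ^+ 2.
  by rewrite -prodrXl; apply: eq_bigr => c _; rewrite sqr_sqrtr.
case: ifPn => [/Exy | _]; last by rewrite mulr_ge0.
rewrite !rtE ler_sqr ?nnegrE // => le_xy.
by rewrite expr2 ler_wpM2l.
Qed.

(** Union bound over the at most [#|X|] wrong answers: each has probability at most [B ^+ n], where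
    [B] bounds the coefficient of every pair of distinct labels. Writing [B ^+ n] as an exponential
    gives [alpha = - ln B]. *)
Lemma maximum_likelihood (x0 : X) : (forall x y, p x =1 p y -> x = y) ->
  exists2 alpha : R, 0 < alpha &
    forall n, exists dec : {ffun 'I_n -> W} -> X, forall x,
      1 - #|X|%:R * expR (- alpha * n%:R) <=
      \sum_(w | dec w == x) \prod_c p x (w c).
Proof.
move=> p_inj.
(* The default 1/2 keeps [B] strictly between 0 and 1 even if all coefficients vanish or there is
   only one label. *)
pose B := \big[Num.max/2^-1]_(xy : X * X | xy.1 != xy.2) bhattacharyya xy.1 xy.2.
have B_lt1 : B < 1.
  apply: bigmax_lt => [|[x y] /= /eqP xy]; first by lra.
  by apply: bhattacharyya_lt1 => /p_inj.
have B_gt0 : 0 < B by apply: lt_le_trans (bigmax_ge_id _ _ _ _); lra.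
exists (- ln B) => [|n]; first by rewrite oppr_gt0 ln_lt0 ?B_gt0.
pose P x (w : {ffun 'I_n -> W}) := \prod_c p x (w c).
pose dec w := [arg max_(x > x0) P x w]%O.
exists dec => x; rewrite -/(P x _).
rewrite opprK expRM_natr lnK ?posrE //.
have -> : \sum_(w | dec w == x) P x w =
    1 - \sum_(y | y != x) \sum_(w | dec w == y) P x w.
  have P_sum1 : \sum_w P x w = 1.
    by rewrite -(bigA_distr_bigA (fun=> p x)) big1 // => c _; exact: p_sum1.
  apply: (canRL (addrK _)); rewrite -[RHS]P_sum1.
  by rewrite [in RHS](partition_big dec predT) //= [in RHS](bigD1 x).
rewrite lerD2l lerN2.
apply: le_trans (_ : \sum_(y | y != x) B ^+ n <= _); last first.
  rewrite sumr_const -[leLHS]mulr_natl ler_wpM2r ?exprn_ge0 ?(ltW B_gt0) // ler_nat.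
  exact: max_card.
apply: ler_sum => y yx; apply: le_trans (likelihood_error (y := y) _) _ => [w|].
  by move=> /eqP <-; rewrite /dec; case: Order.TotalTheory.arg_maxP => // z _; apply.
rewrite lerXn2r ?nnegrE ?bhattacharyya_ge0 ?(ltW B_gt0) //.
have xy : (x, y).1 != (x, y).2 by rewrite eq_sym.
exact: (@le_bigmax_cond _ _ _ _ (x, y) (fun xy => xy.1 != xy.2)
          (fun xy => bhattacharyya xy.1 xy.2) xy).
Qed.

End MaximumLikelihood.

(** * Distributing products over sums indexed by product bases *)

Section JointSums.
Variables (C : comNzRingType) (m : nat).
Implicit Types H : 'I_m -> finType.

Lemma joint_distr H (F : forall i, H i -> C) :
  \prod_(i < m) \sum_(a : H i) F i a =
  \sum_(x : joint H) \prod_(i < m) F i (component x i).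
Proof.
(* The types [H i] vary with [i]; passing to their tagged union makes the choices functions into a
   single type, as the distributivity law requires. *)
rewrite (eq_bigr (fun i => \sum_(u | tagged_with H i u) untag 0 (F i) u));
  last by move=> i _; exact: big_tag.
rewrite bigA_distr_big_dep.
have := @big_fprod _ _ _ _ _ _ H (fun i => [ffun a => F i a] : {ffun H i -> C}).
move=> E; transitivity (\sum_(t : fprod H) \prod_(i < m) F i (t i)).
  transitivity (\sum_(t : fprod H) \prod_(i < m) [ffun a => F i a] (t i)).
    rewrite E; apply: eq_bigr => g gP; apply: eq_bigr => i _.
    by rewrite /untag; case: eqP => // e; rewrite ffunE.
  by apply: eq_bigr => t _; apply: eq_bigr => i _; rewrite ffunE.
rewrite (reindex (@fprod_of_dffun _ H)) /=; last exact/onW_bij/fprod_of_dffun_bij.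
apply: eq_bigr => x _; apply: eq_bigr => i _; congr (F i _).
by rewrite /fprod_of_dffun fprodE.
Qed.

Lemma copyE n H (x : joint (copies n H)) c i :
  component (copy x c) i = (component x i : {ffun _ -> _}) c.
Proof. by rewrite /component ffunE. Qed.

(** A basis label of the copies is a table of parties against copies. Samples read it copy by copy,
    local operations party by party; [join] is the inverse transposition. *)
Lemma sum_copies n H (F : {ffun 'I_n -> joint H} -> C) :
  \sum_w F w = \sum_(x : joint (copies n H)) F [ffun c => copy x c].
Proof.
pose join (f : {ffun 'I_n -> joint H}) : joint (copies n H) :=
  (finfun (fun i => [ffun c => component (f c) i] : copies n H i)
    : {dffun forall i, copies n H i}).
rewrite (reindex (fun x : joint (copies n H) => [ffun c => copy x c])) //.
apply: onW_bij; exists join => [x | f].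
  apply/ffunP => i; rewrite ffunE.
  by apply: (iffLR (@ffunP _ (fun=> H i) _ _)) => c; rewrite !ffunE copyE.
apply/ffunP => c; rewrite ffunE; apply/ffunP => i.
by rewrite !ffunE /component ffunE ffunE.
Qed.

Lemma copies_distr n H (F : 'I_n -> joint H -> C) :
  \prod_(c < n) \sum_(x : joint H) F c x =
  \sum_(x : joint (copies n H)) \prod_(c < n) F c (copy x c).
Proof.
rewrite bigA_distr_bigA sum_copies.
by apply: eq_bigr => x _; apply: eq_bigr => c _; rewrite ffunE.
Qed.

Lemma prod_bool (I : finType) (b : pred I) :
  \prod_i (b i)%:R = [forall i, b i]%:R :> C.
Proof.
case: forallP => [b_true | /forallP]; first by rewrite big1 // => i _; rewrite b_true.
by rewrite negb_forall => /existsP[i /negbTE bi]; rewrite (bigD1 i) //= bi mul0r.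
Qed.

Lemma forall_component_eq H (x y : joint H) :
  [forall i, component x i == component y i] = (x == y).
Proof.
by apply/forallP/eqP => [xy | -> //]; apply/ffunP => i; apply/eqP/xy.
Qed.

Lemma forall_copy_eq n H (x y : joint (copies n H)) :
  [forall c, copy x c == copy y c] = (x == y).
Proof.
apply/forallP/eqP => [xy | -> //]; apply/ffunP => i.
apply: (iffLR (@ffunP _ (fun=> H i) _ _)) => c.
by have /eqP/(congr1 (fun z => component z i)) := xy c; rewrite !copyE.
Qed.

Lemma sum_enum_rank (X : finType) (F : 'I_#|X| -> C) :
  \sum_a F a = \sum_(x : X) F (enum_rank x).
Proof. by rewrite (reindex enum_rank) //; exact/onW_bij/enum_rank_bij. Qed.

End JointSums.

(** * An informationally complete local POVM *)

Section TomographicMeasurement.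
Variables (C : numClosedFieldType) (X : finType).

Definition tomo_outcome : finType := (X * X * 'I_4)%type.

(* The vectors [e_a + i^s e_b], normalized so that their rank-one operators
   resolve the identity; summed over [s] with phases proportional to [i^-s],
   these operators give the matrix unit at (a, b). *)
Definition tomo_vec (j : tomo_outcome) (x : X) : C :=
  sqrtC (8 * #|X|%:R)^-1 * ((x == j.1.1)%:R + 'i ^+ j.2 * (x == j.1.2)%:R).

(** Against the normalization of [tomo_vec], the factor [2 * #|X|%:R] leaves 1/4, the weight of an
    average over the four phases. *)
Definition tomo_dual (s : 'I_4) : C := 2 * #|X|%:R * 'i ^- s.

Lemma tomo_vecM j x y :
  (tomo_vec j x)^* * tomo_vec j y =
  (8 * #|X|%:R)^-1 *
  (((x == j.1.1) && (y == j.1.1))%:R + ((x == j.1.2) && (y == j.1.2))%:R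
   + 'i ^+ j.2 * ((x == j.1.1) && (y == j.1.2))%:R
   + 'i ^- j.2 * ((x == j.1.2) && (y == j.1.1))%:R).
Proof.
rewrite /tomo_vec; set r := sqrtC _.
have r_ge0 : 0 <= r by rewrite sqrtC_ge0 invr_ge0 mulr_ge0.
have rr : r * r = (8 * #|X|%:R)^-1 by rewrite -expr2 sqrtCK.
have ii : 'i ^- j.2 * 'i ^+ j.2 = 1 :> C by rewrite mulVf // expf_neq0 ?neq0Ci.
rewrite -rr !rmorphM !rmorphD !rmorphM !rmorphXn /= !conjC_nat (geC0_conj r_ge0).
have -> : ('i : C)^* ^+ j.2 = 'i ^- j.2 by rewrite conjCi -invCi exprVn.
rewrite -!mulnb !natrM; move: ii; set u := 'i ^- j.2; set v := 'i ^+ j.2 => ii.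
set a := (x == _)%:R; set b := (x == _)%:R; set c := (y == _)%:R; set d := (y == _)%:R.
transitivity (r * r * (a * c + u * v * (b * d) + v * (a * d) + u * (b * c))).
  by ring.
by rewrite ii; ring.
Qed.

Let powCi : ((('i : C) ^+ 0 = 1) * (('i : C) ^+ 1 = 'i) *
  (('i : C) ^+ 2 = -1) * (('i : C) ^+ 3 = - 'i))%type.
Proof. by rewrite expr0 expr1 sqrCi exprS sqrCi mulrN1. Qed.

Let invpowCi : ((('i : C) ^- 0 = 1) * (('i : C) ^- 1 = - 'i) *
  (('i : C) ^- 2 = -1) * (('i : C) ^- 3 = 'i))%type.
Proof. by rewrite !powCi invr1 !invrN invr1 invCi opprK. Qed.

(** The phases ['i ^+ s] sum to zero, which removes the cross terms; each of the two diagonal terms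
    then sums to [#|X|] times the Kronecker delta. *)
Lemma tomo_complete x y :
  \sum_j (tomo_vec j x)^* * tomo_vec j y = (x == y)%:R.
Proof.
have X0 : #|X|%:R != 0 :> C by rewrite pnatr_eq0 -lt0n; apply/card_gt0P; exists x.
rewrite -(pair_bigA _ (fun ab s => (tomo_vec (ab, s) x)^* * tomo_vec (ab, s) y)) /=.
rewrite (eq_bigr (fun ab : X * X => (2 * #|X|%:R)^-1 *
   (((x == ab.1) && (y == ab.1))%:R + ((x == ab.2) && (y == ab.2))%:R))); last first.
  move=> [a b] _ /=; under eq_bigr => s _ do rewrite tomo_vecM /=.
  rewrite !big_ord_recr big_ord0 /=.
  set P := (_ && (y == a))%:R; set Q := ((x == b) && (y == b))%:R.
  set S := (_ && (y == b))%:R; set T := (_ && (y == a))%:R.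
  rewrite !invpowCi !powCi.
  by field.
rewrite -big_distrr /= -(pair_bigA _ (fun a b =>
   ((x == a) && (y == a))%:R + ((x == b) && (y == b))%:R)) /=.
have E : \sum_a ((x == a) && (y == a))%:R = (x == y)%:R :> C.
  rewrite (bigD1 x) //= big1 ?eqxx ?addr0 1?eq_sym // => a.
  by rewrite eq_sym => /negbTE->.
under eq_bigr => a _ do rewrite big_split /= sumr_const E.
rewrite big_split /= sumr_const sumrMnl E -mulr_natl.
by field.
Qed.

(** Fourier inversion over the four phases: against ['i ^- s], only the cross term carrying
    ['i ^+ s] survives. *)
Lemma tomo_recover a b x y :
  \sum_s tomo_dual s * ((tomo_vec (a, b, s) x)^* * tomo_vec (a, b, s) y) =
  ((x == a) && (y == b))%:R.
Proof.
have X0 : #|X|%:R != 0 :> C by rewrite pnatr_eq0 -lt0n; apply/card_gt0P; exists x.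
under eq_bigr => s _ do rewrite tomo_vecM /=.
rewrite !big_ord_recr big_ord0 /= /tomo_dual /=.
set P := (_ && (y == a))%:R; set Q := ((x == b) && (y == b))%:R.
set S := (_ && (y == b))%:R; set T := (_ && (y == a))%:R.
rewrite !invpowCi !powCi.
transitivity (4^-1 * ((2 - 2 * 'i ^+ 2) * S + (2 + 2 * 'i ^+ 2) * T)).
  by field.
by rewrite sqrCi; field.
Qed.

End TomographicMeasurement.

Local Open Scope sesquilinear_scope.

(** * The product POVM on one copy of the system *)

Section ProductTomography.
Variables (R : realType) (m : nat) (H : 'I_m -> finType).
Local Notation C := R[i].

Definition outcomes (i : 'I_m) : finType := tomo_outcome (H i).

(* Every POVM element of this product measurement has rank one: it is the
   projector, up to scale, onto the conjugate of [amp j]. *)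
Definition amp (j : joint outcomes) (x : joint H) : C :=
  \prod_(i < m) tomo_vec C (component j i) (component x i).

(** Born rule: the trace of the POVM element of [j] times [rho], in the product basis. *)
Definition outcome_prob (rho : 'Op[R]_(joint H)) (j : joint outcomes) : C :=
  \sum_x \sum_y (amp j x)^* * amp j y * rho (enum_rank y) (enum_rank x).

Lemma amp_complete x y : \sum_j (amp j x)^* * amp j y = (x == y)%:R.
Proof.
rewrite -forall_component_eq -prod_bool.
under [RHS]eq_bigr => i _ do rewrite -tomo_complete.
rewrite joint_distr; apply: eq_bigr => j _.
by rewrite rmorph_prod -big_split.
Qed.

Lemma outcome_prob_ge0 rho j : positive_op rho -> 0 <= outcome_prob rho j.
Proof.
move=> /(_ (\col_a (amp j (enum_val a))^*)); congr (0 <= _).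
rewrite mxE sum_enum_rank; apply: eq_bigr => x _.
rewrite mxE sum_enum_rank mulr_suml; apply: eq_bigr => y _.
by rewrite !mxE !enum_rankK conjCK; ring.
Qed.

Lemma sum_outcome_prob rho : \sum_j outcome_prob rho j = \tr rho.
Proof.
rewrite /mxtrace sum_enum_rank exchange_big; apply: eq_bigr => x _ /=.
rewrite exchange_big (bigD1 x) //= [X in _ + X]big1 => [|y yx].
  by rewrite -mulr_suml amp_complete eqxx mul1r addr0.
by rewrite -mulr_suml amp_complete eq_sym (negbTE yx) mul0r.
Qed.

(** Linear inversion: dual coefficients and amplitudes both factor over the parties, so
    [tomo_recover] applies at each party and the sum over all phase choices isolates one entry. *)
Lemma outcome_prob_recover (rho : 'Op[R]_(joint H)) (a b : joint H) :
  rho (enum_rank b) (enum_rank a) =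
  \sum_(s : {ffun 'I_m -> 'I_4}) (\prod_i tomo_dual C (H i) (s i)) *
    outcome_prob rho (finfun (fun i => (component a i, component b i, s i) : outcomes i)
                      : {dffun forall i, outcomes i}).
Proof.
under eq_bigr => s _ do rewrite mulr_sumr.
rewrite exchange_big /=.
under eq_bigr => x _.
  under eq_bigr => s _ do rewrite mulr_sumr.
  rewrite exchange_big /=.
  under eq_bigr => y _.
    rewrite (_ : \sum_s _ =
      ((x == a) && (y == b))%:R * rho (enum_rank y) (enum_rank x)); last first.
      under eq_bigr => s _ do rewrite mulrA.
      rewrite -mulr_suml -mulnb natrM -!forall_component_eq -!prod_bool -big_split /=.
      under [X in _ = X * _]eq_bigr => i _ do rewrite -natrM mulnb -tomo_recover.
      rewrite bigA_distr_bigA; congr (_ * _); apply: eq_bigr => s _.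
      rewrite /amp rmorph_prod -!big_split; apply: eq_bigr => i _ /=.
      by rewrite /component !ffunE.
    over.
  over.
rewrite (bigD1 a) //= (bigD1 b) //= !eqxx mul1r.
rewrite big1 ?addr0 => [|y /negbTE->]; last by rewrite mul0r.
by rewrite big1 ?addr0 // => x /negbTE->; rewrite big1 // => y _; rewrite mul0r.
Qed.

Lemma outcome_prob_inj rho sigma :
  outcome_prob rho =1 outcome_prob sigma -> rho = sigma.
Proof.
move=> eq_p; apply/matrixP => a b; rewrite -(enum_valK a) -(enum_valK b).
by rewrite !outcome_prob_recover; apply: eq_bigr => s _; rewrite eq_p.
Qed.

End ProductTomography.

(** * The one-round LOCC protocol that measures every copy *)

Section CopywiseMeasurement.
Variables (R : realType) (m : nat) (H : 'I_m -> finType) (n : nat).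
Variables (O : finType) (dec : joint (copies n (outcomes H)) -> O).
Local Notation C := R[i].

Definition trivial_system : 'I_m -> finType := fun=> unit.

(* Each Kraus operator is a bra, so nothing is left after the measurement. *)
Definition copy_kraus (i : 'I_m) (j : copies n (outcomes H) i) :
    'M[C]_(#|trivial_system i|, #|copies n H i|) :=
  \matrix_(z, y) \prod_c tomo_vec C ((j : {ffun _ -> _}) c)
                                    ((enum_val y : {ffun _ -> _}) c).

Lemma copy_krausE i (j : copies n (outcomes H) i) z (y : copies n H i) :
  copy_kraus j z (enum_rank y) =
  \prod_c tomo_vec C ((j : {ffun _ -> _}) c) ((y : {ffun _ -> _}) c).
Proof. by rewrite mxE enum_rankK. Qed.

Lemma copy_kraus_complete i :
  \sum_j (copy_kraus j)^t* *m copy_kraus j = 1%:M :> 'M[C]_#|copies n H i|.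
Proof.
apply/matrixP => a b; rewrite summxE mxE.
transitivity (\sum_(j : copies n (outcomes H) i) \prod_c
   ((tomo_vec C ((j : {ffun _ -> _}) c) ((enum_val a : {ffun _ -> _}) c))^* *
    tomo_vec C ((j : {ffun _ -> _}) c) ((enum_val b : {ffun _ -> _}) c))).
  apply: eq_bigr => j _; rewrite mxE sum_enum_rank (bigD1 tt) //= big1 ?addr0.
    by rewrite !mxE rmorph_prod -big_split.
  by case.
rewrite -(bigA_distr_bigA (fun c (o : outcomes H i) =>
  (tomo_vec C o ((enum_val a : {ffun _ -> _}) c))^* *
   tomo_vec C o ((enum_val b : {ffun _ -> _}) c))).
under eq_bigr => c _ do rewrite tomo_complete.
rewrite prod_bool; congr ((nat_of_bool _)%:R); apply/forallP/eqP => [ab | -> //].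
by apply/enum_val_inj/(iffLR (@ffunP _ (fun=> H i) _ _)) => c; apply/eqP/ab.
Qed.

Definition copywise_protocol : protocol R O (copies n H) :=
  Round copy_kraus_complete (fun j => Announce R trivial_system (dec j)).

Lemma effect_copywiseE o x y :
  effect copywise_protocol o (enum_rank x) (enum_rank y) =
  \sum_(j | dec j == o)
    \prod_c ((amp R (copy j c) (copy x c))^* * amp R (copy j c) (copy y c)).
Proof.
rewrite /= summxE [RHS]big_mkcond /=; apply: eq_bigr => j _.
set K := tensor _.
have KE z w : K z (enum_rank w) = \prod_c amp R (copy j c) (copy w c).
  rewrite mxE [RHS]exchange_big /=; apply: eq_bigr => i _.
  rewrite enum_rankK; etransitivity; first exact: copy_krausE.
  apply: eq_bigr => c _.
  by rewrite !copyE.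
rewrite mul_mx_scalar -scalemxAl mxE mxE.
rewrite (eq_bigr (fun=> (\prod_c amp R (copy j c) (copy x c))^* *
                        \prod_c amp R (copy j c) (copy y c))); last first.
  by move=> z _; rewrite -!(KE z); congr (_ * _); clearbody K; rewrite !mxE.
rewrite sumr_const card_ord.
(* All output spaces are one-dimensional, so the sum over the middle index has a single term. *)
have -> : #|joint trivial_system| = 1%N.
  apply: (@eq_card1 _ (finfun (fun=> tt) : {dffun forall _ : 'I_m, unit})) => z.
  by rewrite !inE; apply/esym/eqP/ffunP => i; case: (z i); case: (finfun _ i).
by case: eqP => _; rewrite ?mul0r // mul1r rmorph_prod -big_split.
Qed.

Lemma positive_op_gram p q (K : 'M[C]_(p, q)) : positive_op (K^t* *m K).
Proof.
move=> v; rewrite mulmxA -map_mxM -trmx_mul -mulmxA mxE.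
by apply: sumr_ge0 => i _; rewrite !mxE mulrC mul_conjC_ge0.
Qed.

(** Each effect is a sum of Gram operators [K^t* *m K]. Summing over the outcomes drops [dec], and
    completeness then holds copy by copy. *)
Lemma copywise_locc : locc_measurement (effect copywise_protocol).
Proof.
split; last by exists copywise_protocol.
split=> [o v | ].
  rewrite /= mulmx_sumr mulmx_suml summxE; apply: sumr_ge0 => j _.
  rewrite mul_mx_scalar -scalemxAl -scalemxAr -scalemxAl mxE.
  by rewrite mulr_ge0 ?ler0n // positive_op_gram.
apply/matrixP => a b; rewrite summxE mxE -{1}(enum_valK a) -{1}(enum_valK b).
under eq_bigr => o _ do rewrite effect_copywiseE.
transitivity (\sum_j \prod_c ((amp R (copy j c) (copy (enum_val a) c))^*
                               * amp R (copy j c) (copy (enum_val b) c))).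
  by rewrite [RHS](partition_big dec predT).
rewrite -(copies_distr (fun c j =>
  (amp R j (copy (enum_val a) c))^* * amp R j (copy (enum_val b) c))).
under eq_bigr => c _ do rewrite amp_complete.
by rewrite prod_bool forall_copy_eq (inj_eq enum_val_inj).
Qed.

(** Effects and [tensor_power n rho] both factor over the copies, so [dec] is fed i.i.d. samples
    from [outcome_prob rho]. *)
Lemma trace_copywise o (rho : 'Op[R]_(joint H)) :
  \tr (effect copywise_protocol o *m tensor_power n rho) =
  \sum_(j | dec j == o) \prod_c outcome_prob rho (copy j c).
Proof.
rewrite /mxtrace sum_enum_rank.
under eq_bigr => x _.
  rewrite mxE sum_enum_rank.
  under eq_bigr => y _ do rewrite effect_copywiseE mulr_suml.
  rewrite exchange_big /=; over.
rewrite exchange_big /=; apply: eq_bigr => j _.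
rewrite copies_distr; apply: eq_bigr => x _.
rewrite copies_distr; apply: eq_bigr => y _.
by rewrite mxE !enum_rankK -big_split.
Qed.

End CopywiseMeasurement.

(** * The orbit of [rho] and the left cosets of its stabilizer *)

Section Orbit.
Variables (R : realType) (G : finGroupType) (n : nat).
Variables (U : G -> 'M[R[i]]_n) (rho : 'M[R[i]]_n).
Hypothesis U_proj : projective_unitary U.

Lemma unitary_conj_inj g : injective (unitary_conj (U g)).
Proof.
have uU := U_proj.1 g.
move=> A B /(congr1 (fun X => (U g)^t* *m X *m U g)); rewrite /unitary_conj.
have UtU : (U g)^t* *m U g = 1%:M by apply/mulmx1C/unitarymxP.
by rewrite !mulmxA UtU !mul1mx -!mulmxA UtU !mulmx1.
Qed.

(** The phase [c] meets its conjugate and cancels, so conjugation is a genuine group action although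
    [U] is only projective. *)
Lemma unitary_conjM g h A :
  unitary_conj (U g) (unitary_conj (U h) A) = unitary_conj (U (g * h)%g) A.
Proof.
have [c c1 UU] := U_proj.2 g h.
transitivity (unitary_conj (U g *m U h) A).
  by rewrite /unitary_conj trmx_mul map_mxM !mulmxA.
rewrite UU /unitary_conj linearZ /= map_mxZ -!scalemxAl -scalemxAr scalerA.
by rewrite -normCK c1 expr1n scale1r.
Qed.

(** [U 1%g] need not be the identity matrix, but conjugating by it twice equals conjugating once,
    and conjugation is injective. *)
Lemma unitary_conj1 A : unitary_conj (U 1%g) A = A.
Proof. by apply: (@unitary_conj_inj 1%g); rewrite unitary_conjM mulg1. Qed.

Lemma stabilizerP g : reflect (unitary_conj (U g) rho = rho) (g \in stabilizer U rho).
Proof. by rewrite inE; apply: eqP. Qed.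

Lemma group_set_stabilizer : group_set (stabilizer U rho).
Proof.
apply/group_setP; split=> [|g h /stabilizerP gS /stabilizerP hS].
  exact/stabilizerP/unitary_conj1.
by apply/stabilizerP; rewrite -unitary_conjM hS.
Qed.

(** Orbit-stabilizer: moving [g] across, equality of the states says that [g^-1 * h] fixes [rho]. *)
Lemma orbit_eqP g h :
  unitary_conj (U g) rho = unitary_conj (U h) rho <->
  (g *: stabilizer U rho = h *: stabilizer U rho)%g.
Proof.
set S := stabilizer U rho; pose SG := Group group_set_stabilizer.
have lcosetE : (h *: S = g *: S)%g <-> (g^-1 * h)%g \in S.
  by rewrite -mem_lcoset; split=> /(@lcoset_eqP _ SG).
split=> [eq_gh | /esym/lcosetE/stabilizerP gh].
  apply/esym/lcosetE/stabilizerP.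
  by rewrite -unitary_conjM -eq_gh unitary_conjM mulVg unitary_conj1.
by rewrite -{1}gh unitary_conjM mulKVg.
Qed.

Lemma density_unitary_conj g : density rho -> density (unitary_conj (U g) rho).
Proof.
move=> [rho_ge0 tr1]; split=> [v|].
  have := rho_ge0 ((U g)^t* *m v).
  by rewrite trmx_mul map_mxM trmxCK /unitary_conj !mulmxA.
rewrite /unitary_conj mxtrace_mulC mulmxA.
by have /mulmx1C-> := unitarymxP (U_proj.1 g); rewrite mul1mx.
Qed.

Lemma left_coset_repr (X : left_cosets (stabilizer U rho)) :
  left_coset (stabilizer U rho) (repr (val X)) = X.
Proof.
apply: val_inj => /=; case: X => Y /= /lcosetsP[g _ ->].
pose SG := Group group_set_stabilizer.
exact/(@lcoset_eqP _ SG)/(mem_repr g)/(@lcoset_refl _ SG).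
Qed.

End Orbit.

(** * From the classical error bound to the LOCC success probability *)

Theorem lemma5 (R : realType) (m : nat) (H : 'I_m -> finType)
    (G : finGroupType) (U : G -> 'Op[R]_(joint H)) (rho : 'Op[R]_(joint H))
    (U_proj : projective_unitary U) (U_loc : forall g, local_unitary (U g))
    (rho_state : density rho) :
  let S := stabilizer U rho in
  let N := #|left_cosets S| in
  exists2 alpha : R, 0 < alpha &
    forall k : nat, (0 < k)%N ->
      exists M : left_cosets S -> 'Op[R]_(joint (copies (k * N)%N H)),
        locc_measurement M /\
        forall g : G,
          real_complex R (1 - N%:R * expR (- alpha * k%:R)) <=
          \tr (M (left_coset S g)
               *m tensor_power (k * N)%N (unitary_conj (U g) rho)).
Proof.
move=> S N.
(* The choice of representative is harmless: by [orbit_eqP] the state depends only on the coset. *)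
pose state (X : left_cosets S) := unitary_conj (U (repr (val X))) rho.
have state_coset g : state (left_coset S g) = unitary_conj (U g) rho.
  apply/orbit_eqP => //; have := left_coset_repr U_proj (left_coset S g).
  by move/(congr1 val).
have state_density X : density (state X) by exact: density_unitary_conj.
have state_inj X Y : state X = state Y -> X = Y.
  move=> /(orbit_eqP _ U_proj) XY; rewrite -(left_coset_repr U_proj X).
  by rewrite -(left_coset_repr U_proj Y); apply: val_inj.
(* The Born probabilities have type [R[i]] but are real by positivity, so taking real parts loses
   nothing. *)
pose p X w : R := complex.Re (outcome_prob (state X) w).
have pE X w : outcome_prob (state X) w = real_complex R (p X w).
  by rewrite /p RRe_real // ger0_real // outcome_prob_ge0 //; case: (state_density X).
have p_ge0 X w : 0 <= p X w.
  by rewrite -ler0c -pE outcome_prob_ge0 //; case: (state_density X).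
have p_sum1 X : \sum_w p X w = 1.
  apply: (@complexI R); rewrite rmorph_sum rmorph1 -(state_density X).2.
  by rewrite -sum_outcome_prob; apply: eq_bigr => w _; rewrite pE.
have p_inj X Y : p X =1 p Y -> X = Y.
  by move=> pXY; apply/state_inj/outcome_prob_inj => w; rewrite !pE pXY.
have [alpha alpha_gt0 decode] :=
  maximum_likelihood p_ge0 p_sum1 (left_coset S 1%g) p_inj.
exists alpha => // k k_gt0; have [dec dec_ok] := decode (k * N)%N.
pose copy_dec (j : joint (copies (k * N) (outcomes H))) := dec [ffun c => copy j c].
exists (effect (copywise_protocol R copy_dec)); split; first exact: copywise_locc.
move=> g; rewrite -state_coset trace_copywise.
have -> : \sum_(j | copy_dec j == left_coset S g)
    \prod_c outcome_prob (state (left_coset S g)) (copy j c) =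
  real_complex R (\sum_(w | dec w == left_coset S g)
    \prod_c p (left_coset S g) (w c)).
  rewrite big_mkcond [in RHS]big_mkcond sum_copies rmorph_sum; apply: eq_bigr => j _.
  rewrite -/(copy_dec j); case: ifP => _; rewrite ?rmorph0 // rmorph_prod.
  by apply: eq_bigr => c _; rewrite pE ffunE.
rewrite lecR; apply: le_trans (dec_ok _).
(* The [k * N] samples give the error exponent [- alpha * (k * N)], at most [- alpha * k] because
   there is at least one coset. *)
rewrite lerD2l lerN2 ler_wpM2l ?ler0n // ler_expR !mulNr lerN2.
rewrite ler_wpM2l ?(ltW alpha_gt0) //.
rewrite ler_nat leq_pmulr //.
by apply/card_gt0P; exists (left_coset S 1%g).
Qed.
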